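(* Assume that $0\le\operatorname{trace}(\mathcal A(x)\,\xi\otimes\xi)\le\Lambda$ for all $x\in\Omega$, $\xi\in\mathbb R^N$, $|\xi|=1$ (with $\Lambda>0$), that the Keller–Osserman condition $\int^{+\infty}\frac{ds}{\sqrt{G(s)}}<+\infty$ holds, and that there is $\omega:[0,\infty)\to[0,\infty)$ with $\omega(0^+)=0$ such that $$\operatorname{trace}(\mathcal A(x)X)-\operatorname{trace}(\mathcal A(y)Y)\le\omega\big(\alpha|x-y|^2\big)$$ whenever $x,y\in\Omega$, $\alpha>0$ and $X,Y\in\mathcal S^N$ satisfy $$-3\alpha\begin{pmatrix} I&0\\0&I\end{pmatrix}\le\begin{pmatrix}X&0\\0&-Y\end{pmatrix}\le3\alpha\begin{pmatrix}I&-I\\-I&I\end{pmatrix}.$$ For $0<\varepsilon<1$ let $u_\varepsilon(x)=\sup_n u_{\varepsilon,n}(x)$, $x\in\Omega$, where $u_{\varepsilon,n}$ is the classical solution of $$-\varepsilon\Delta u_{\varepsilon,n}-\operatorname{trace}\mathcal A(\cdot)D^2u_{\varepsilon,n}+\beta(u_{\varepsilon,n})=\min\{f,n\}\ \text{ in }\Omega,\qquad u_{\varepsilon,n}=n\ \text{ on }\partial\Omega .$$ Then there exist two positive constants $A$ and $B$, independent of $\varepsilon\in(0,1)$, for which $$u_{\varepsilon}(x)\le\sum_{i=1}^N\Psi_1\big(R^2-|x_i-x_{0,i}|^2\big)+\beta^{-1}\big(\|f\|_{Q_R(x_0)}\big),\quad x\in Q_R(x_0),$$ holds in any cube $Q_R(x_0)=\{x\in\mathbb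 R^N:|x_i-x_{0,i}|<R,\ i=1,\dots,N\}\subset\subset\Omega$, where $$\Psi_1(\zeta)=\frac1A\,\Phi^{-1}\Big(\frac{B}{\sqrt{\Lambda+1}}\,\zeta\Big),\quad 0<\zeta\le R^2,\qquad\text{with } \frac{B R^2}{\sqrt{\Lambda+1}}<\Phi(0^+)\le+\infty .$$
   Context: $\Omega\subset\mathbb R^N$, $N>1$, is a bounded open set. $\mathcal S^N$ is the set of real symmetric $N\times N$ matrices with its usual ordering and $\mathcal S^N_+$ those with nonnegative eigenvalues. $\mathcal A:\Omega\to\mathcal S^N_+\setminus\{0\}$ is Lipschitz continuous; $\operatorname{trace}(\mathcal A\,\xi\otimes\xi)=\langle\mathcal A\xi,\xi\rangle$. $\beta:[0,\infty)\to[0,\infty)$ is continuous and increasing with $\beta(0)=0$; $f$ is a nonnegative uniformly continuous function on $\Omega$. $G(s)=\int_0^s\beta(r)\,dr$ and $\Phi(t)=\int_t^{+\infty}\frac{ds}{\sqrt{2G(s)}}$, $t>0$, a decreasing function with inverse $\Phi^{-1}$ and $\Phi(0^+)=\lim_{t\searrow0}\Phi(t)$. $\|f\|_{Q_R(x_0)}$ is the supremum norm of $f$ on $Q_R(x_0)$. The functions $u_{\varepsilon,n}\in C^2(\Omega)$ (attaining the boundary value $n$) are taken to exist, as in the classical theory; the sequence is increasing in $n$. *)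

(* Defs.v *)
From HB Require Import structures.
From mathcomp Require Export all_boot all_order all_algebra.
From mathcomp Require Export all_classical all_reals all_analysis.
Export Order.TTheory GRing.Theory Num.Theory.
Export numFieldNormedType.Exports.

#[export] Set Implicit Arguments.
#[export] Unset Strict Implicit.
#[export] Unset Printing Implicit Defensive.

Local Open Scope classical_set_scope.
Local Open Scope ring_scope.

(* Points of R^N are row vectors.  The norm that the library puts on 'rV[R]_N
   is the sup norm; it is used for topological notions only, while [enorm] is
   used wherever the value of the Euclidean norm matters. *)
Definition enorm (R : realType) (N : nat) (v : 'rV[R]_N) : R :=
  Num.sqrt (\sum_(i < N) v 0 i ^+ 2).

Definition cube (R : realType) (N : nat) (x0 : 'rV[R]_N) (r : R) :
    set 'rV[R]_N :=
  [set x | forall i, `|x 0 i - x0 0 i| < r].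

(* The rank-one matrix xi (x) xi. *)
Definition tens (R : realType) (N : nat) (xi : 'rV[R]_N) : 'M[R]_N :=
  xi^T *m xi.

Definition symmetric_mx (R : realType) (n : nat) (X : 'M[R]_n) : Prop :=
  X^T = X.

Definition psd_mx (R : realType) (n : nat) (X : 'M[R]_n) : Prop :=
  symmetric_mx X /\ forall a : R, eigenvalue X a -> 0 <= a.

Definition le_mx (R : realType) (n : nat) (X Y : 'M[R]_n) : Prop :=
  forall xi : 'rV[R]_n,
    (xi *m X *m xi^T) 0 0 <= (xi *m Y *m xi^T) 0 0.

(* -3a (I 0; 0 I) <= (X 0; 0 -Y) <= 3a (I -I; -I I) *)
Definition doubling_bound (R : realType) (N : nat) (a : R) (X Y : 'M[R]_N) :
    Prop :=
  let XY := block_mx X 0 0 (- Y) in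
  le_mx (- (3 * a) *: block_mx 1%:M 0 0 1%:M) XY /\
  le_mx XY ((3 * a) *: block_mx 1%:M (- 1%:M) (- 1%:M) 1%:M).

Definition structure_condition (R : realType) (N : nat) (Omega : set 'rV[R]_N)
    (cA : 'rV[R]_N -> 'M[R]_N) (omega : R -> R) : Prop :=
  forall (x y : 'rV[R]_N) (a : R) (X Y : 'M[R]_N),
    Omega x -> Omega y -> 0 < a -> symmetric_mx X -> symmetric_mx Y ->
    doubling_bound a X Y ->
    \tr (cA x *m X) - \tr (cA y *m Y) <= omega (a * enorm (x - y) ^+ 2).

Definition unif_continuous_on (R : realType) (N : nat) (D : set 'rV[R]_N)
    (f : 'rV[R]_N -> R) : Prop :=
  forall e : R, 0 < e -> exists2 d : R, 0 < d &
    forall x y, D x -> D y -> `|x - y| < d -> `|f x - f y| < e.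

Definition boundary (T : topologicalType) (D : set T) : set T :=
  closure D `\` interior D.

Definition sup_norm (R : realType) (N : nat) (D : set 'rV[R]_N)
    (f : 'rV[R]_N -> R) : R :=
  sup [set `|f x| | x in D].

Definition partial (R : realType) (N : nat) (i : 'I_N) (u : 'rV[R]_N -> R) :
    'rV[R]_N -> R :=
  fun x => 'D_(delta_mx 0 i) u x.

Definition hessian (R : realType) (N : nat) (u : 'rV[R]_N -> R)
    (x : 'rV[R]_N) : 'M[R]_N :=
  \matrix_(i, j) partial i (partial j u) x.

Definition laplacian (R : realType) (N : nat) (u : 'rV[R]_N -> R)
    (x : 'rV[R]_N) : R :=
  \sum_(i < N) partial i (partial i u) x.

(* Twice continuously differentiable on the open set D. *)
Definition C2_on (R : realType) (N : nat) (D : set 'rV[R]_N)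
    (u : 'rV[R]_N -> R) : Prop :=
  forall x, D x ->
    [/\ {for x, continuous u},
        forall i, derivable u x (delta_mx 0 i) /\
                  {for x, continuous (partial i u)} &
        forall i j, derivable (partial j u) x (delta_mx 0 i) /\
                    {for x, continuous (partial i (partial j u))}].

(* Functions defined on [0, +oo) are represented by total functions R -> R, of
   which only the restriction to [0, +oo) is ever used. *)
Definition G (R : realType) (beta : R -> R) (s : R) : R :=
  (\int[lebesgue_measure]_(r in `[0%R, s]) beta r)%R.

(* The Keller-Osserman condition: 1 / sqrt G is integrable near +oo. *)
Definition keller_osserman (R : realType) (beta : R -> R) : Prop :=
  exists2 t : R, 0 < t &
    (\int[lebesgue_measure]_(s in `[t, +oo[)
       ((Num.sqrt (G beta s))^-1)%:E < +oo)%E.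

Definition Phi (R : realType) (beta : R -> R) (t : R) : R :=
  (\int[lebesgue_measure]_(s in `[t, +oo[) (Num.sqrt (2 * G beta s))^-1)%R.

(* Phi(0+), possibly +oo. *)
Definition Phi0 (R : realType) (beta : R -> R) : \bar R :=
  lim ((Phi beta t)%:E @[t --> 0^'+]).

Definition Phi_inv (R : realType) (beta : R -> R) : R -> R :=
  pinv (`]0, +oo[ : set R) (Phi beta).

(* The inverse of beta : [0, +oo) -> [0, +oo). *)
Definition beta_inv (R : realType) (beta : R -> R) : R -> R :=
  pinv (`[0, +oo[ : set R) beta.

Definition Psi1 (R : realType) (beta : R -> R) (Lambda A B zeta : R) : R :=
  A^-1 * Phi_inv beta (B / Num.sqrt (Lambda + 1) * zeta).

(* v is the classical solution u_{eps,n}.  It is nonnegative on Omega because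
   beta(v) has to make sense, beta being defined on [0, +oo) only. *)
Definition classical_solution (R : realType) (N : nat) (Omega : set 'rV[R]_N)
    (cA : 'rV[R]_N -> 'M[R]_N) (beta : R -> R) (f : 'rV[R]_N -> R)
    (eps : R) (n : nat) (v : 'rV[R]_N -> R) : Prop :=
  [/\ C2_on Omega v,
      {within closure Omega, continuous v},
      forall x, Omega x -> 0 <= v x,
      forall x, Omega x ->
        - eps * laplacian v x - \tr (cA x *m hessian v x) + beta (v x)
        = Num.min (f x) n%:R &
      forall x, boundary Omega x -> v x = n%:R].

(* u_eps = sup_n u_{eps,n}, a priori with values in [0, +oo]. *)
Definition sup_seq (R : realType) (N : nat) (un : nat -> 'rV[R]_N -> R)
    (x : 'rV[R]_N) : \bar R :=
  ereal_sup (range (fun n => (un n x)%:E)).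

(* Main.v *)
Require Import Defs.
From mathcomp Require Import ring lra measurable_realfun.

Local Open Scope classical_set_scope.
Local Open Scope ring_scope.

(** The proof compares each [u_n] on the cube with the explicit barrier

      v(x) = h(kappa (r^2 - |x_1 - x0_1|^2)) + ... + h(kappa (r^2 - |x_N - x0_N|^2)) + c,

    where [h = Phi_inv beta], [kappa = B / sqrt (Lambda + 1)], [A = 1] and
    [beta c] is the norm of [f] on the cube.  As [Phi' = - 1 / sqrt (2 G)], the
    function [h] satisfies [h' = - sqrt (2 G h)] and [h'' = beta h], and it tends
    to [+oo] at 0; hence [v] tends to [+oo] at the boundary of the cube, and its
    hessian is diagonal with the nonnegative entries
    [2 kappa sqrt (2 G h_i) + 4 kappa^2 (x_i - x0_i)^2 beta h_i].

    Everything rests on choosing [B] small in terms of the diameter of [Omega].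
    Then the argument of [h] stays below [Phi M] for all cubes inside [Omega], so
    that all [h_i] exceed [M], where [M] may be prescribed.
    - The Keller-Osserman condition gives [sqrt (2 G s) <= C beta s] for [s >= 2]
      ([gspeed_le_beta]) and makes [beta] unbounded ([beta_unbounded]).  So the
      second order terms of [v] are at most a small multiple of [beta v].
    - As [f] is bounded ([unif_continuous_bounded]), [M] can be taken with
      [beta M >= 2 beta c], so that [beta v - beta c >= beta v / 2].
    Together, [v] is a supersolution ([barrier_supersolution]) of the regularized
    equation for all [eps] in (0, 1) and all [n].

    If [u_n > v] somewhere in the cube, the blow-up of [v] makes [u_n - v] attain
    its maximum at an interior point.  There the hessians are ordered as quadratic
    forms ([hessian_le_at_max]), hence so are their traces against the positive
    semidefinite matrices [cA] and 1 ([psd_nsd_trace]); the equation for [u_n]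
    then contradicts the monotonicity of [beta] ([solution_le_barrier]). *)

(** * Quadratic forms *)

Definition bform (R : realType) (n : nat) (A : 'M[R]_n) (x y : 'rV[R]_n) : R :=
  (x *m A *m y^T) 0 0.

Section bform.
Variables (R : realType) (n : nat).
Implicit Types (A S : 'M[R]_n) (x y p : 'rV[R]_n).

Lemma bformDl A x y z : bform A (x + y) z = bform A x z + bform A y z.
Proof. by rewrite /bform !mulmxDl mxE. Qed.

Lemma bformDr A x y z : bform A z (x + y) = bform A z x + bform A z y.
Proof. by rewrite /bform linearD mulmxDr mxE. Qed.

Lemma bformZl A a x y : bform A (a *: x) y = a * bform A x y.
Proof. by rewrite /bform -!scalemxAl mxE. Qed.

Lemma bformZr A a x y : bform A x (a *: y) = a * bform A x y.
Proof. by rewrite /bform linearZ -scalemxAr mxE. Qed.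

Lemma bformC A x y : symmetric_mx A -> bform A x y = bform A y x.
Proof.
move=> sA; rewrite /bform; transitivity ((x *m A *m y^T)^T 0 0).
  by rewrite [in RHS]mxE.
by rewrite !trmx_mul trmxK sA mulmxA.
Qed.

Lemma bform_delta A i j : bform A (delta_mx 0 i) (delta_mx 0 j) = A i j.
Proof. by rewrite /bform -rowE trmx_delta -colE !mxE. Qed.

Lemma bform_deltal A i x : bform A (delta_mx 0 i) x = \sum_j A i j * x 0 j.
Proof. by rewrite /bform -rowE mxE; apply: eq_bigr => j _; rewrite !mxE. Qed.

Lemma bform_tens p x : bform (tens p) x x = (\sum_j p 0 j * x 0 j) ^+ 2.
Proof.
rewrite /bform /tens mulmxA -mulmxA mxE big_ord1 expr2; congr (_ * _).
  by rewrite mxE; apply: eq_bigr => j _; rewrite mxE mulrC.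
by rewrite mxE; apply: eq_bigr => j _; rewrite mxE.
Qed.

Lemma mxtrace_tens A p : \tr (A *m tens p) = bform A p p.
Proof. by rewrite /tens mulmxA mxtrace_mulC mulmxA trace_mx11. Qed.

Lemma bformBmx A S x y : bform (A - S) x y = bform A x y - bform S x y.
Proof. by rewrite /bform mulmxBr mulmxBl mxE [in X in _ + X]mxE. Qed.

Lemma bformZmx a A x y : bform (a *: A) x y = a * bform A x y.
Proof. by rewrite /bform -scalemxAr -scalemxAl mxE. Qed.

(** A vanishing diagonal entry kills its row: otherwise the form would be
    affine and non constant along a line. *)
Lemma psd_diag0 A (i j : 'I_n) : symmetric_mx A ->
  (forall x, 0 <= bform A x x) -> A i i = 0 -> A i j = 0.
Proof.
move=> sA pA Aii; apply/eqP/negPn/negP => Aij0.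
(* the multiple of the first basis vector is the one that gives the value -1 *)
have := pA ((- (A j j + 1) / (2 * A i j)) *: delta_mx 0 i + delta_mx 0 j).
rewrite !(bformDl, bformDr, bformZl, bformZr, bform_delta) Aii.
have -> : A j i = A i j by rewrite -[in LHS]sA mxE.
set t := _ / _; have : t * A i j = - (A j j + 1) / 2.
  by rewrite /t; field.
by lra.
Qed.

(** Completing the square (a step of the Cholesky decomposition). *)
Lemma psd_pivot A (k : 'I_n) : symmetric_mx A ->
  (forall x, 0 <= bform A x x) -> A k k != 0 ->
  forall x, 0 <= bform (A - (A k k)^-1 *: tens (row k A)) x x.
Proof.
move=> sA pA a0 x; rewrite bformBmx bformZmx bform_tens.
under eq_bigr do rewrite mxE; rewrite -bform_deltal.
set a := A k k; set b := bform A (delta_mx 0 k) x.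
have := pA (x + (- (a^-1 * b)) *: delta_mx 0 k).
rewrite !(bformDl, bformDr, bformZl, bformZr) bform_delta -/a.
rewrite (bformC x (delta_mx 0 k) sA) -/b.
set E := (X in 0 <= X); set F := (X in _ -> 0 <= X).
suff -> : E = F by [].
by rewrite /E /F; field.
Qed.

(** Subtracting pivots one row at a time writes [A] as a sum of nonnegative
    multiples of rank-one matrices, whose traces against [S] are values of the
    form of [S]; here [k] bounds the number of rows still to be eliminated. *)
Lemma psd_nsd_trace_rec A S (k : nat) : symmetric_mx A ->
  (forall x, 0 <= bform A x x) -> (forall x, bform S x x <= 0) ->
  (forall i j : 'I_n, (k <= i)%N -> A i j = 0) -> \tr (A *m S) <= 0.
Proof.
move=> + + nS; elim: k A => [|k IH] A sA pA zA.
  by rewrite (_ : A = 0) ?mul0mx ?mxtrace0//; apply/matrixP=> i j; rewrite zA ?mxE.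
have [kn|nk] := ltnP k n; last first.
  by apply: IH => // i j ki; have := leq_trans nk ki; rewrite leqNgt ltn_ord.
pose K := Ordinal kn.
have [a0|a0] := eqVneq (A K K) 0.
  apply: IH => // i j; rewrite leq_eqVlt => /orP[/eqP ki|]; last exact: zA.
  by rewrite (_ : i = K) ?(psd_diag0 j sA pA a0)//; apply: val_inj.
have aK : 0 < A K K.
  by rewrite lt_def a0 -bform_delta pA.
rewrite -[A](subrK ((A K K)^-1 *: tens (row K A))) mulmxDl mxtraceD.
rewrite -scalemxAl mxtraceZ [\tr (tens _ *m _)]mxtrace_mulC mxtrace_tens.
have := nS (row K A); set q := bform _ _ _ => q0.
suff : \tr ((A - (A K K)^-1 *: tens (row K A)) *m S) <= 0.
  have : (A K K)^-1 * q <= 0 by rewrite pmulr_rle0 ?invr_gt0.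
  by lra.
apply: IH.
- rewrite /symmetric_mx linearB linearZ /= sA /tens trmx_mul trmxK//.
- exact: psd_pivot.
- move=> i j; rewrite !mxE big_ord1 !mxE leq_eqVlt => /orP[/eqP ki|ki].
    rewrite (_ : i = K); last exact: val_inj.
    by rewrite mulrA mulVf// mul1r subrr.
  have -> : A K i = A i K by rewrite -[in LHS]sA mxE.
  by rewrite (zA i j ki) (zA i K ki) mul0r mulr0 subr0.
Qed.

Lemma psd_nsd_trace A S : symmetric_mx A ->
  (forall x, 0 <= bform A x x) -> (forall x, bform S x x <= 0) ->
  \tr (A *m S) <= 0.
Proof.
move=> sA pA nS; apply: (@psd_nsd_trace_rec _ _ n) => // i j.
by rewrite leqNgt ltn_ord.
Qed.

End bform.
(** * Directional derivatives *)

Section dir.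
Variables (R : realType) (V : normedModType R).
Implicit Types (u : V -> R) (x v a b : V).

Lemma is_derive_lineP u x v (s d : R) :
  is_derive (x + s *: v) v u d <-> is_derive s 1 (fun t => u (x + t *: v)) d.
Proof.
have E : (fun h : R => h^-1 *:
      ((u \o shift (x + s *: v)) (h *: v) - u (x + s *: v))) =
    (fun h : R => h^-1 *:
      (((fun t => u (x + t *: v)) \o shift s) (h *: 1) - u (x + s *: v))).
  apply/funext => h /=; congr (_ *: (u _ - _)).
  by rewrite [h *: 1]mulr1 scalerDl addrCA.
by split=> -[du Du]; split; move: du Du; rewrite /derivable /derive E.
Qed.

Lemma is_deriveZdir u x v (c d : R) :
  is_derive x v u d -> is_derive x (c *: v) u (c * d).
Proof.
move=> du; rewrite -[x]addr0 -(scale0r (c *: v)).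
apply/is_derive_lineP.
rewrite (_ : (fun t => _) = (fun t => u (x + t *: v)) \o ( *%R c)); last first.
  by apply/funext => t /=; rewrite scalerA mulrC.
rewrite mulrC.
have dl : is_derive (0 : R) 1 ( *%R c) c.
  by apply: is_derive_eq (is_deriveZ c (is_derive_id (0 : R) 1)) _; exact: mulr1. 
apply: is_derive1_comp.
apply/is_derive_lineP; by rewrite mulr0 scale0r addr0.
Qed.

(** The increment along [a + b] is the increment along [a] followed by one along
    [b] from a moving base point; the mean value theorem turns the latter into a
    value of ['D_b u] near [x].  Only at [x] is derivability along [a] required,
    so that the lemma can be iterated over the coordinates. *)
Lemma is_deriveDdir u x a b : derivable u x a ->
  (\forall y \near x, derivable u y b) -> {for x, continuous ('D_b u)} ->
  is_derive x (a + b) u ('D_a u x + 'D_b u x).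
Proof.
move=> da db cb.
pose q (w : V) (h : R) := h^-1 *: ((u \o shift x) (h *: w) - u x).
suff cq : q (a + b) h @[h --> 0^'] --> 'D_a u x + 'D_b u x.
  split; first by apply/cvg_ex; eexists; exact: cq.
  exact: cvg_lim cq.
have -> : q (a + b) = (fun h => q a h + (q (a + b) h - q a h)).
  by apply/funext => h; rewrite addrCA subrr addr0.
apply: cvgD; first exact: da.
apply/cvgrPdist_lt => e e0.
have : \forall y \near x, derivable u y b /\ `|'D_b u x - 'D_b u y| < e.
  by near=> y; split; near: y => //; move/cvgrPdist_lt: cb; exact.
rewrite -nbhs_nearE => /nbhs_ballP[d /= d0 Hd].
pose C := `|a| + `|b| + 1.
have C0 : 0 < C by rewrite /C ltr_wpDl// addr_ge0.
near=> h.
have h0 : h != 0 by near: h; exact: nbhs_dnbhs_neq.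
have hd : `|h| * C < d.
  rewrite -ltr_pdivlMr//; near: h; apply: dnbhs0_lt; by rewrite divr_gt0.
have inb (s : R) : 0 <= s <= 1 -> ball x d (x + h *: a + (s * h) *: b).
  move=> s01; rewrite -ball_normE /= -addrA opprD addNKr normrN.
  apply: le_lt_trans hd; apply: (le_trans (ler_normD _ _)).
  rewrite !normrZ (ger0_norm (_ : 0 <= s)); last by case/andP: s01.
  have : s * `|h| * `|b| <= `|h| * `|b|.
    by apply: ler_wpM2r => //; apply: ler_piMl => //; case/andP: s01.
  rewrite /C !mulrDr mulr1; have := normr_ge0 h; lra.
pose phi s := u (x + h *: a + s *: (h *: b)).
have dphi (s : R) : 0 <= s <= 1 ->
    is_derive s (1 : R) phi (h * 'D_b u (x + h *: a + (s * h) *: b)).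
  move=> s01; apply/is_derive_lineP; rewrite scalerA; apply: is_deriveZdir.
  by have [dy _] := Hd _ (inb s s01); split.
have [||s s01 E] := @MVT R phi
  (fun s => h * 'D_b u (x + h *: a + (s * h) *: b)) 0 1 ltr01.
- by move=> s; rewrite in_itv/= => /andP[s0 s1]; apply: dphi; lra.
- apply: derivable_within_continuous => s; rewrite in_itv/= => s01.
  by have [] := dphi s s01.
have -> : q (a + b) h - q a h = 'D_b u (x + h *: a + (s * h) *: b).
  rewrite /q -scalerBr opprB addrA subrK.
  have -> : (u \o shift x) (h *: (a + b)) - (u \o shift x) (h *: a) = phi 1 - phi 0.
    rewrite /phi scale1r scale0r addr0 /= scalerDr; congr (u _ - u _).
    - by rewrite addrC addrA.
    - by rewrite addrC.
  by rewrite E subr0 mulr1 scalerA mulVf// scale1r.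
have s01' : 0 <= s <= 1 by move: s01; rewrite in_itv/= => /andP[s0 s1]; lra.
by have [_] := Hd _ (inb s s01').
Unshelve. all: by end_near. Qed.

Lemma is_deriveDZdir u x a b (c : R) : derivable u x a ->
  (\forall y \near x, derivable u y b) -> {for x, continuous ('D_b u)} ->
  is_derive x (a + c *: b) u ('D_a u x + c * 'D_b u x).
Proof.
move=> da db cb.
have Dc : \forall y \near x, is_derive y (c *: b) u (c * 'D_b u y).
  by apply: filterS db => y dy; apply: is_deriveZdir; split.
have Dcx : 'D_(c *: b) u x = c * 'D_b u x by have [_] := nbhs_singleton Dc.
suff H : is_derive x (a + c *: b) u ('D_a u x + 'D_(c *: b) u x) by rewrite Dcx in H.
apply: is_deriveDdir; [exact: da|by apply: filterS Dc => y []|].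
rewrite /prop_for /continuous_at Dcx.
have cc : c * 'D_b u y @[y --> x] --> c * 'D_b u x.
  by apply: cvgM; [exact: cvg_cst|exact: cb].
have /cvgrPdist_lt cc' := cc; apply/cvgrPdist_lt => e e0.
by apply: filterS2 Dc (cc' e e0) => y [_ ->].
Qed.

End dir.

(** * Second order conditions at a maximum *)

Section euclid.
Variables (R : realType) (N : nat).
Implicit Types (u : 'rV[R]_N -> R) (x xi : 'rV[R]_N).

Lemma is_derive_partial u x xi :
  (forall i, \forall y \near x, derivable u y (delta_mx 0 i)) ->
  (forall i, {for x, continuous (partial i u)}) ->
  is_derive x xi u (\sum_i xi 0 i * partial i u x).
Proof.
move=> du cu; rewrite [xi in is_derive _ xi]row_sum_delta.
elim: (index_enum _) => [|i s IH]; first by rewrite !big_nil; exact: is_derive0.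
rewrite !big_cons addrC [X in is_derive _ _ _ X]addrC.
have [dIH <-] := IH; by apply: is_deriveDZdir => //; exact: cu.
Qed.

(** [is_derive_partial] applies to [u] and again to its partial derivatives, which
    yields the second derivative of [u] along a line as a quadratic form. *)
Lemma C2_line2 (D : set 'rV[R]_N) u x xi : open D -> C2_on D u -> D x ->
  exists g1 : R -> R,
    (\forall t \near (0 : R),
      is_derive (t : R) 1 (fun t => u (x + t *: xi)) (g1 t)) /\
    is_derive (0 : R) 1 g1 (bform (hessian u x) xi xi).
Proof.
move=> oD C2u Dx; exists (fun t => \sum_i xi 0 i * partial i u (x + t *: xi)).
have nD y : D y -> \forall z \near y, D z by move=> Dy; apply: open_nbhs_nbhs.
split.
  have : \forall t \near (0 : R), D (x + t *: xi).
    have c : x + t *: xi @[t --> (0 : R)] --> x + (0 : R) *: xi.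
      by apply: cvgD; [exact: cvg_cst|apply: cvgZr_tmp; exact: cvg_id].
    by rewrite scale0r addr0 in c; exact: (c _ (nD _ Dx)).
  apply: filterS => t Dt.
  apply: (is_derive_lineP u x xi t _).1.
  apply: is_derive_partial => i.
    by apply: filterS (nD _ Dt) => y /C2u[_ /(_ i)[]].
  by have [_ /(_ i)[]] := C2u _ Dt.
rewrite (_ : bform _ _ _ =
    \sum_i xi 0 i * \sum_j xi 0 j * partial j (partial i u) x); last first.
  rewrite /bform mxE; apply: eq_bigr => i _; rewrite [in X in _ * X]mxE mulrC.
  by rewrite mxE; congr (_ * _); apply: eq_bigr => j _; rewrite mxE.
have -> : (fun t => \sum_i xi 0 i * partial i u (x + t *: xi)) =
    \sum_i (fun t => xi 0 i * partial i u (x + t *: xi)).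
  by apply/funext => t; rewrite fct_sumE.
apply: is_derive_sum => i.
apply: (is_deriveZ (xi 0 i)).
apply: (is_derive_lineP (partial i u) x xi 0 _).1.
rewrite scale0r addr0.
apply: is_derive_partial => j.
  by apply: filterS (nD _ Dx) => y /C2u[_ _ /(_ j i)[]].
by have [_ _ /(_ j i)[]] := C2u _ Dx.
Qed.

End euclid.

(** A positive [l] would make [g1] positive on the right of its zero 0, so that
    [g] would increase there. *)
Lemma second_derivative_max (R : realType) (g g1 : R -> R) (l : R) :
  (\forall t \near (0 : R), is_derive (t : R) 1 g (g1 t)) ->
  is_derive (0 : R) 1 g1 l ->
  (\forall t \near (0 : R), g t <= g 0) -> l <= 0.
Proof.
move=> dg dg1 gmax; rewrite leNgt; apply/negP => l0.
have [k [kE ck k0]] := (is_derive1_caratheodory g1 0 l).1 dg1.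
have kpos : \forall t \near (0 : R), 0 < k t.
  move/cvgrPdist_lt : ck => /(_ l l0); apply: filterS => t.
  by rewrite k0 ltr_norml; lra.
have : \forall t \near (0 : R),
    [/\ is_derive (t : R) 1 g (g1 t), g t <= g 0 & 0 < k t].
  by near=> t; split; near: t.
rewrite -nbhs_nearE => /nbhs_ballP[d /= d0 Hd].
have bd (t : R) : - d < t < d ->
    [/\ is_derive (t : R) 1 g (g1 t), g t <= g 0 & 0 < k t].
  by move=> td; apply: Hd; rewrite -ball_normE /= sub0r normrN ltr_norml.
have g10 : g1 0 = 0.
  have [|[_ <-] _ _] := bd 0; first lra.
  suff [] : is_derive (0 : R) 1 g 0 by [].
  apply: (@derive1_at_max R g (- d) d 0).
  - lra.
  - by move=> t; rewrite in_itv/= => /bd[[]].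
  - by rewrite in_itv/=; lra.
  - by move=> t; rewrite in_itv/= => /bd[].
have [|||c + E] := @MVT R g g1 0 (d / 2).
- lra.
- by move=> t; rewrite in_itv/= => td; have [|] := bd t; [lra|].
- apply: derivable_within_continuous => t; rewrite in_itv/= => td.
  by have [|[]] := bd t; [lra|].
rewrite in_itv/= => cd; have [|_ _ kc] := bd c; first lra.
have [|_ gd _] := bd (d / 2); first lra.
have := kE c; rewrite g10 !subr0 => g1c; rewrite g1c in E.
have : 0 < k c * c * (d / 2 - 0) by rewrite !mulr_gt0//; lra.
by rewrite -E; lra.
Unshelve. all: by end_near. Qed.

(** * Boxes, cubes and bounded functions *)

Section space.
Variables (R : realType) (N : nat).
Implicit Types (x y z xi : 'rV[R]_N) (D : set 'rV[R]_N) (r : R).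

Definition box x0 r : set 'rV[R]_N := [set x | forall i, `|x 0 i - x0 0 i| <= r].

Lemma box_compact x0 r : compact (box x0 r).
Proof.
have -> : box x0 r = [set v : 'rV[R]_N | forall i,
    `[x0 0 i - r, x0 0 i + r]%classic (v ord0 i)].
  by apply/seteqP; split => x /= + i => /(_ i); rewrite in_itv/= ler_distl.
apply: (@rV_compact R N (fun i => `[x0 0 i - r, x0 0 i + r]%classic)) => i.
exact: segment_compact.
Qed.

Lemma closure_cube_compact x0 r : compact (closure (cube x0 r)).
Proof.
apply: (subclosed_compact (@closed_closure _ _) (box_compact (x0 := x0) (r := r))).
have /closure_id -> : closed (box x0 r).
  by apply: compact_closed; [exact: norm_hausdorff|exact: box_compact].
by apply: closure_subset => x cx i; rewrite ltW.
Qed.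

Lemma norm_coord_le x i : `|x 0 i| <= `|x|.
Proof.
rewrite [X in _ <= X]/Num.norm /= mx_normrE.
exact: (le_bigmax _ (fun ij : 'I_1 * 'I_N => `|x ij.1 ij.2|) (0, i)).
Qed.

Lemma bounded_in_box D : bounded_set D -> exists2 Q, 0 < Q & D `<=` box 0 Q.
Proof.
move=> [Q [_ DQ]]; exists (`|Q| + 1); first by rewrite ltr_wpDl.
move=> x Dx i; rewrite mxE subr0; apply: le_trans (norm_coord_le x i) _.
by apply: DQ => //; rewrite (le_lt_trans (ler_norm Q))// ltrDl.
Qed.

(** The set [D] may be disconnected, which rules out a chain of small steps inside
    [D]; the local bounds are instead patched together by compactness of a box
    around [D]. *)
Lemma unif_continuous_bounded D (f : 'rV[R]_N -> R) : bounded_set D ->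
  unif_continuous_on D f -> exists2 F, 0 <= F & forall x, D x -> `|f x| <= F.
Proof.
move=> bD uf; have [Q Q0 DQ] := bounded_in_box bD.
have [d d0 fd] := uf 1 ltr01.
have d20 : 0 < d / 2 by rewrite divr_gt0.
have /compact_near_coveringP cov := @box_compact 0 Q.
have : \forall F \near +oo, box 0 Q `<=` (fun F x => D x -> `|f x| <= F) F.
  apply: cov => x _.
  have [[y [Dy xy]]|noy] := pselect (exists y, D y /\ ball x (d / 2) y).
    exists (ball x (d / 2), [set F : R | `|f y| + 1 <= F]); first split => /=.
    - exact: nbhsx_ballx.
    - by apply: nbhs_pinfty_ge; rewrite num_real.
    - move=> [x' F] /= [xx' yF] Dx'; apply: le_trans yF.
      have : `|x' - y| < d.
        rewrite -ball_normE /= in xy; rewrite -ball_normE /= in xx'.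
        rewrite -(subrK x x') -addrA; apply: le_lt_trans (ler_normD _ _) _.
        by rewrite distrC [d]splitr ltrD.
      move=> /(fd _ _ Dx' Dy) fxy; rewrite -(subrK (f y) (f x')) addrC.
      by apply: le_trans (ler_normD _ _) _; rewrite lerD2l ltW.
  exists (ball x (d / 2), setT).
    by split => /=; [exact: nbhsx_ballx|exact: filterT].
  by move=> [x' F] /= [xx' _] Dx'; exfalso; apply: noy; exists x'.
move=> H; near (+oo : set_system R) => F; exists F.
  by near: F; apply: nbhs_pinfty_ge; rewrite num_real.
by move=> x Dx; apply: (near H F) => //; exact: DQ.
Unshelve. all: by end_near. Qed.

Lemma cube_near_line x0 r z xi : cube x0 r z ->
  \forall t \near (0 : R), cube x0 r (z + t *: xi).
Proof.
move=> cz.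
suff H i : \forall t \near (0 : R), `|(z + t *: xi) 0 i - x0 0 i| < r.
  exact: (filter_forall _ H).
have c : (z 0 i + t * xi 0 i) - x0 0 i @[t --> (0 : R)] -->
    (z 0 i + 0 * xi 0 i) - x0 0 i.
  apply: cvgB; last exact: cvg_cst.
  apply: cvgD; first exact: cvg_cst.
  by apply: cvgM; [exact: cvg_id|exact: cvg_cst].
rewrite mul0r addr0 in c.
have H : \forall t \near (0 : R), `|z 0 i + t * xi 0 i - x0 0 i| < r.
  exact: cvgr_norm_lt c _ (cz i).
by apply: filterS H => t; rewrite !mxE.
Qed.

(** The second derivative of [v] is supplied along lines only, which is how the
    barrier below is differentiated. *)
Lemma hessian_le_at_max D (u v : 'rV[R]_N -> R) z (S : 'M[R]_N) :
  open D -> C2_on D u -> D z ->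
  (forall xi, exists v1 : R -> R,
    (\forall t \near (0 : R),
      is_derive (t : R) 1 (fun t => v (z + t *: xi)) (v1 t)) /\
    is_derive (0 : R) 1 v1 (bform S xi xi)) ->
  (forall xi, \forall t \near (0 : R),
    u (z + t *: xi) - v (z + t *: xi) <= u z - v z) ->
  forall xi, bform (hessian u z - S) xi xi <= 0.
Proof.
move=> oD Cu Dz dv zmax xi.
have [u1 [du1 du2]] := C2_line2 xi oD Cu Dz; have [v1 [dv1 dv2]] := dv xi.
rewrite bformBmx.
pose U (t : R) := u (z + t *: xi); pose V (t : R) := v (z + t *: xi).
apply: (@second_derivative_max _ (U - V) (u1 - v1)).
- by apply: filterS2 du1 dv1 => t dU dV; exact: (is_deriveB dU dV).
- apply: filterS (zmax xi) => t; rewrite -![(U - V) _]/(U _ - V _) /U /V.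
  by rewrite !scale0r !addr0.
Qed.

End space.

(** * The function Phi *)

Section absorption.
Variables (R : realType) (beta : R -> R).
Implicit Types a b s t x y M : R.
Hypothesis beta_ge0 : forall s, 0 <= s -> 0 <= beta s.
Hypothesis beta_continuous : {within `[0, +oo[, continuous beta}.
Hypothesis beta_increasing : forall s t, 0 <= s -> s < t -> beta s < beta t.
Hypothesis beta0 : beta 0 = 0.

Local Notation mu := (@lebesgue_measure R).

Lemma beta_gt0 s : 0 < s -> 0 < beta s.
Proof. by move=> s0; rewrite -beta0; exact: beta_increasing. Qed.

Lemma beta_le s t : 0 <= s -> s <= t -> beta s <= beta t.
Proof.
by move=> s0; rewrite le_eqVlt => /orP[/eqP->//|st]; rewrite ltW// beta_increasing.
Qed.

Lemma beta_continuous_at s : 0 < s -> {for s, continuous beta}.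
Proof.
move=> s0; move/continuous_within_itvcyP : beta_continuous => [+ _].
by apply; rewrite in_itv/= s0.
Qed.

Lemma beta_integrable s : mu.-integrable `[0, s] (EFin \o beta).
Proof.
apply: continuous_compact_integrable; first exact: segment_compact.
apply: continuous_subspaceW beta_continuous => x /=.
by rewrite !in_itv/= => /andP[->].
Qed.

Lemma is_derive_G s : 0 < s -> is_derive s 1 (G beta) (beta s).
Proof.
move=> s0; have ss1 : s < s + 1 by rewrite ltrDl.
have [dG GE] := continuous_FTC1_closed ss1 (beta_integrable (s + 1)) s0
  (beta_continuous_at s0).
by split; [exact: dG|rewrite -GE derive1E].
Qed.

Lemma G_continuous s : 0 < s -> {for s, continuous (G beta)}.
Proof.
move=> s0; apply: differentiable_continuous; apply/derivable1_diffP.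
by have [] := is_derive_G s0.
Qed.

Lemma G_mvt s : 0 < s -> exists2 c, 0 < c < s & G beta s = beta c * s.
Proof.
move=> s0; have [||c + E] := @MVT R (G beta) beta 0 s s0.
- by move=> x; rewrite in_itv/= => /andP[x0 _]; exact: is_derive_G.
- exact: (parameterized_integral_continuous (ltW s0) (beta_integrable s)).
- rewrite in_itv/= => cs; exists c => //.
  have G0 : G beta 0 = 0 by rewrite /G set_itv1 Rintegral_set1.
  by move: E; rewrite G0 !subr0.
Qed.

Lemma G_gt0 s : 0 < s -> 0 < G beta s.
Proof.
by move=> s0; have [c /andP[c0 _] ->] := G_mvt s0; rewrite mulr_gt0// beta_gt0.
Qed.

Lemma G_le s : 0 < s -> G beta s <= beta s * s.
Proof.
move=> s0; have [c /andP[c0 cs] ->] := G_mvt s0.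
by rewrite ler_wpM2r ?(ltW s0)// beta_le// ltW.
Qed.

Lemma G_homo s t : 0 < s -> s <= t -> G beta s <= G beta t.
Proof.
move=> s0 st; have [||c + E] := @MVT_segment R (G beta) beta s t st.
- by move=> x; rewrite in_itv/= => /andP[x0 _]; apply: is_derive_G; lra.
- apply: derivable_within_continuous => x; rewrite in_itv/= => /andP[x0 _].
  by have [] := is_derive_G (lt_le_trans s0 x0).
- rewrite in_itv/= => /andP[sc _]; rewrite -subr_ge0 E mulr_ge0 ?subr_ge0//.
  by apply: beta_ge0; lra.
Qed.

(** The inverse [h] of [Phi] solves [h' = - gspeed h]. *)
Definition gspeed s := Num.sqrt (2 * G beta s).

Lemma gspeed_gt0 s : 0 < s -> 0 < gspeed s.
Proof. by move=> s0; rewrite sqrtr_gt0 mulr_gt0// G_gt0. Qed.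

Lemma gspeed_homo s t : 0 < s -> s <= t -> gspeed s <= gspeed t.
Proof. by move=> s0 st; rewrite ler_wsqrtr// ler_pM2l// G_homo. Qed.

Lemma sqr_gspeed s : 0 < s -> gspeed s ^+ 2 = 2 * G beta s.
Proof. by move=> s0; rewrite sqr_sqrtr// mulr_ge0// ltW// G_gt0. Qed.

Lemma is_derive_gspeed s : 0 < s -> is_derive s 1 gspeed (beta s / gspeed s).
Proof.
move=> s0.
have d2 : is_derive s 1 (fun x => 2 * G beta x) (2 * beta s).
  by apply: (is_deriveZ 2); exact: is_derive_G.
have G0 := G_gt0 s0; have G20 : 0 < 2 * G beta s by rewrite mulr_gt0.
have := @is_derive1_comp R Num.sqrt (fun x => 2 * G beta x) s _ _
  (is_derive1_sqrt G20) d2.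
rewrite (_ : _ \o _ = gspeed)// => /is_derive_eq; apply.
by rewrite -/(gspeed s); field; rewrite gt_eqF// gspeed_gt0.
Qed.

Lemma gspeed_continuous s : 0 < s -> {for s, continuous gspeed}.
Proof.
move=> s0; apply: differentiable_continuous; apply/derivable1_diffP.
by have [] := is_derive_gspeed s0.
Qed.

Lemma invgspeed_continuous s : 0 < s -> {for s, continuous (fun x => (gspeed x)^-1)}.
Proof.
move=> s0; apply: continuousV; last exact: gspeed_continuous.
by rewrite gt_eqF// gspeed_gt0.
Qed.

Hypothesis beta_KO : keller_osserman beta.

(** Near [+oo] this is the Keller-Osserman condition; on the remaining compact
    interval the integrand is continuous. *)
Lemma invgspeed_integrable t : 0 < t ->
  mu.-integrable `[t, +oo[ (EFin \o (fun s => (gspeed s)^-1)).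
Proof.
move=> t0.
have mg (phi : R -> R) (a : R) : (forall s, 0 < s -> {for s, continuous phi}) ->
    0 < a -> measurable_fun `[a, +oo[ phi.
  move=> cphi a0; apply: subspace_continuous_measurable_fun => //.
  apply: continuous_in_subspaceT => x; rewrite inE/= in_itv/= andbT => ax.
  by apply: cphi; exact: lt_le_trans ax.
have [a a0 fina] := beta_KO.
have inta : mu.-integrable `[a, +oo[ (EFin \o (fun s => (gspeed s)^-1)).
  apply/integrableP; split.
    apply/measurable_EFinP; apply: mg => //; exact: invgspeed_continuous.
  apply: le_lt_trans fina; apply: ge0_le_integral => //=.
  - apply/measurable_EFinP; apply: measurableT_comp => //; apply: mg => //.
    exact: invgspeed_continuous.
  - have cG s : 0 < s -> {for s, continuous (fun s => (Num.sqrt (G beta s))^-1)}.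
      move=> s0; apply: continuousV; first by rewrite gt_eqF// sqrtr_gt0 G_gt0.
      by apply: continuous_comp; [exact: G_continuous|exact: sqrt_continuous].
    have m1 := mg _ _ cG a0; apply/measurable_EFinP; exact: m1.
  - move=> x; rewrite in_itv/= andbT => ax; have x0 := lt_le_trans a0 ax.
    have G0 := G_gt0 x0; rewrite lee_fin ger0_norm ?invr_ge0 ?sqrtr_ge0//.
    rewrite lef_pV2 ?posrE ?sqrtr_gt0 ?mulr_gt0//.
    by rewrite ler_wsqrtr// ler_peMl ?ltW ?ltr1n.
have [ta|at_] := leP t a; last first.
  apply: integrableS inta => // x /=; rewrite !in_itv/= !andbT.
  by apply: le_trans; exact: ltW.
have mgt : measurable_fun `[t, +oo[ (fun s => (gspeed s)^-1).
  by apply: mg => //; exact: invgspeed_continuous.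
apply/integrableP; split; first exact/measurable_EFinP.
have tu : `[t, +oo[%classic = `[t, a[%classic `|` `[a, +oo[%classic :> set R.
  by rewrite -itv_bndbnd_setU// bnd_simp.
rewrite tu ge0_integral_setU//=; last 2 first.
- by rewrite -tu; apply/measurable_EFinP; apply: measurableT_comp.
- apply/disj_setPS => y [/=]; rewrite 2!in_itv/= => /andP[_ yx] /andP[].
  by rewrite leNgt yx.
apply: lte_add_pinfty; last by have /integrableP[] := inta.
suff /integrableP[] :
  mu.-integrable `[t, a[ (EFin \o (fun s => (gspeed s)^-1)) by [].
have : mu.-integrable `[t, a] (EFin \o (fun s => (gspeed s)^-1)).
  apply: continuous_compact_integrable; first exact: segment_compact.
  apply: continuous_in_subspaceT => x; rewrite inE/= in_itv/= => /andP[tx _].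
  by apply: invgspeed_continuous; exact: lt_le_trans tx.
by apply: integrableS => // x /=; rewrite !in_itv/= => /andP[-> /ltW].
Qed.

Lemma PhiB a b : 0 < a -> a <= b ->
  Phi beta a - \int[mu]_(s in `[a, b]) (gspeed s)^-1 = Phi beta b.
Proof.
move=> a0 ab; rewrite /Phi (Rintegral_itvB (invgspeed_integrable a0)) ?bnd_simp//.
rewrite Rintegral_itv_obnd_cbnd//.
apply: integrableS (invgspeed_integrable a0) => // x /=.
by rewrite !in_itv/= !andbT => /ltW; exact: le_trans.
Qed.

Lemma is_derive_Phi t : 0 < t -> is_derive t 1 (Phi beta) (- (gspeed t)^-1).
Proof.
move=> t0; have a0 : 0 < t / 2 by rewrite divr_gt0.
have at_ : t / 2 < t by lra.
have tt1 : t < t + 1 by rewrite ltrDl.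
have ia : mu.-integrable `[t / 2, t + 1] (EFin \o (fun s => (gspeed s)^-1)).
  apply: integrableS (invgspeed_integrable a0) => // x /=.
  by rewrite !in_itv/= andbT => /andP[].
have [dG GE] := continuous_FTC1_closed tt1 ia at_ (invgspeed_continuous t0).
set F := (fun x => _) in dG GE.
have dF : is_derive t 1 F (gspeed t)^-1 by split; [exact: dG|rewrite -GE derive1E].
have : is_derive t 1 (cst (Phi beta (t / 2)) - F) (- (gspeed t)^-1).
  by apply: is_derive_eq; rewrite sub0r.
apply: near_eq_is_derive.
near=> x; rewrite -(@PhiB (t / 2) x)//.
by apply/ltW; near: x; exact: lt_nbhsr.
Unshelve. all: by end_near. Qed.

Lemma Phi_continuous t : 0 < t -> {for t, continuous (Phi beta)}.
Proof.
move=> s0; apply: differentiable_continuous; apply/derivable1_diffP.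
by have [] := is_derive_Phi s0.
Qed.

Lemma Phi_mvt a b : 0 < a -> a < b ->
  exists2 c, a < c < b & Phi beta a - Phi beta b = (b - a) / gspeed c.
Proof.
move=> a0 ab; have [||c + E] := @MVT R (Phi beta) (fun x => - (gspeed x)^-1) a b ab.
- by move=> x; rewrite in_itv/= => /andP[x0 _]; apply: is_derive_Phi; lra.
- apply: derivable_within_continuous => x; rewrite in_itv/= => /andP[x0 _].
  by have [] := is_derive_Phi (lt_le_trans a0 x0).
- by rewrite in_itv/= => ac; exists c => //; rewrite -opprB E mulrC mulrN opprK.
Qed.

Lemma Phi_decr a b : 0 < a -> a < b -> Phi beta b < Phi beta a.
Proof.
move=> a0 ab; have [c /andP[ac cb] E] := Phi_mvt a0 ab.
rewrite -subr_gt0 E divr_gt0 ?subr_gt0// gspeed_gt0//; lra.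
Qed.

Lemma Phi_nincr a b : 0 < a -> a <= b -> Phi beta b <= Phi beta a.
Proof.
by move=> a0; rewrite le_eqVlt => /orP[/eqP->//|ab]; rewrite ltW// Phi_decr.
Qed.

Lemma Phi_ge0 t : 0 <= Phi beta t.
Proof. by apply: Rintegral_ge0 => x _; rewrite invr_ge0. Qed.

Lemma Phi_gt0 t : 0 < t -> 0 < Phi beta t.
Proof.
move=> t0; apply: le_lt_trans (Phi_ge0 (t + 1)) _.
by apply: Phi_decr => //; rewrite ltrDl.
Qed.

(** By monotonicity [- Phi] has a limit [L] at infinity.  The fundamental theorem
    of calculus on the half-line from 1 gives [Phi 1 = L + Phi 1]. *)
Lemma Phi_cvgy : Phi beta x @[x --> +oo] --> 0.
Proof.
(* truncated below 1, since [Phi] is monotone on positive arguments only *)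
pose F x := - Phi beta (Num.max x 1).
have ndF : nondecreasing_fun F.
  move=> x y xy; rewrite lerN2 Phi_nincr ?lt_max ?ltr01 ?orbT//.
  by rewrite ge_max !le_max xy lexx orbT.
have ubF : has_ubound (range F).
  by exists 0 => _ [x _ <-]; rewrite oppr_le0 Phi_ge0.
have := nondecreasing_cvgr ndF ubF; set L := sup _ => FL.
have FE : \forall x \near +oo, F x = - Phi beta x.
  by near=> x; rewrite /F max_l.
have PL : - Phi beta x @[x --> +oo] --> L.
  by apply: cvg_trans FL; apply: near_eq_cvg; apply: filterS FE => x ->.
have := @Rintegral_ge0_continuous_FTC2y R (fun s => (gspeed s)^-1)
  (fun x => - Phi beta x) 1 L.
have -> : (\int[mu]_(s in `[1, +oo[) (gspeed s)^-1 = Phi beta 1) by [].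
move=> H; suff L0 : L = 0.
  have P0 : (- (fun x => - Phi beta x)) x @[x --> +oo] --> - L by exact: cvgN.
  move: P0; have -> : - (fun x => - Phi beta x) = Phi beta.
    by apply/funext => x; exact: opprK.
  by rewrite L0 oppr0.
suff : Phi beta 1 = L - (- Phi beta 1).
  by rewrite opprK -[X in X = _]add0r => /addIr/esym.
apply: H => //.
- by move=> x x1; rewrite invr_ge0 sqrtr_ge0.
- apply: continuous_in_subspaceT => x; rewrite inE/= in_itv/= andbT => x1.
  by apply: invgspeed_continuous; exact: lt_le_trans x1.
- by move=> x x1; apply: derivableN; have [] := is_derive_Phi (lt_trans ltr01 x1).
- apply: cvg_at_right_filter; apply: cvgN; exact: (Phi_continuous ltr01).
- move=> x; rewrite in_itv/= andbT => x1.
  have [dP PE] := is_derive_Phi (lt_trans ltr01 x1).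
  by rewrite derive1E deriveN// PE opprK.
Unshelve. all: by end_near. Qed.

(** * The inverse of Phi *)

Lemma Phi_surj M y : 0 < M -> 0 < y < Phi beta M ->
  exists2 t, M < t & Phi beta t = y.
Proof.
move=> M0 /andP[y0 yM].
have [T MT TY] : exists2 T, M < T & Phi beta T < y.
  near (+oo : set_system R) => T; exists T.
    by near: T; apply: nbhs_pinfty_gt; rewrite num_real.
  rewrite -[X in X < _]ger0_norm ?Phi_ge0// -normrN -sub0r; near: T.
  by move/cvgrPdist_lt : Phi_cvgy; exact.
have [||t + tE] := @IVT R (Phi beta) M T y (ltW MT).
- apply: continuous_in_subspaceT => x; rewrite inE/= in_itv/= => /andP[Mx _].
  by apply: Phi_continuous; exact: lt_le_trans Mx.
- by rewrite ge_min le_max (ltW TY) (ltW yM) orbT.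
rewrite in_itv/= => /andP[Mt _]; exists t => //.
rewrite lt_neqAle Mt andbT; apply/eqP => Mt'.
by move: yM; rewrite -tE Mt' ltxx.
Unshelve. all: by end_near. Qed.

Lemma Phi_invK t : 0 < t -> Phi_inv beta (Phi beta t) = t.
Proof.
move=> t0; apply: pinvKV; last by rewrite inE/= in_itv/= t0.
move=> a b; rewrite !inE/= !in_itv/= !andbT => a0 b0 ab.
by have [/(Phi_decr a0)|/(Phi_decr b0)|//] := ltgtP a b; rewrite ab ltxx.
Qed.

Lemma Phi_inv_gt M y : 0 < M -> 0 < y < Phi beta M -> M < Phi_inv beta y.
Proof.
by move=> M0 /(Phi_surj M0)[t Mt <-]; rewrite Phi_invK// (lt_trans M0).
Qed.

Lemma is_derive_Phi_inv M y : 0 < M -> 0 < y < Phi beta M ->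
  is_derive y 1 (Phi_inv beta) (- gspeed (Phi_inv beta y)).
Proof.
move=> M0 yM; have [t Mt tE] := Phi_surj M0 yM; have t0 := lt_trans M0 Mt.
have nt : \forall x \near t, 0 < x by exact: lt_nbhsr.
rewrite -tE Phi_invK//.
have -> : - gspeed t = (- (gspeed t)^-1)^-1 by rewrite invrN invrK.
apply: is_derive_inverse.
- by apply: filterS nt => x; exact: Phi_invK.
- by apply: filterS nt => x; exact: Phi_continuous.
- exact: is_derive_Phi.
- by rewrite oppr_eq0 invr_eq0 gt_eqF// gspeed_gt0.
Qed.

Lemma is_derive_gspeed_Phi_inv M y : 0 < M -> 0 < y < Phi beta M ->
  is_derive y 1 (fun z => - gspeed (Phi_inv beta z)) (beta (Phi_inv beta y)).
Proof.
move=> M0 yM; have h0 := lt_trans M0 (Phi_inv_gt M0 yM).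
have := is_deriveN (@is_derive1_comp R gspeed (Phi_inv beta) y _ _
  (is_derive_gspeed h0) (is_derive_Phi_inv M0 yM)).
move=> /is_derive_eq; apply.
by field; rewrite gt_eqF// gspeed_gt0.
Qed.

Lemma Phi_le_Phi0 M : 0 < M -> ((Phi beta M)%:E <= Phi0 beta)%E.
Proof.
move=> M0; rewrite /Phi0.
have nP : {in Interval (BRight 0) +oo%O &,
    nonincreasing_fun (fun t => (Phi beta t)%:E)}.
  move=> x y; rewrite !in_itv/= !andbT => x0 y0 xy.
  by rewrite lee_fin Phi_nincr.
have := @nonincreasing_at_right_cvge R (fun t => (Phi beta t)%:E) 0 +oo%O _ nP.
move=> /(_ isT)/cvg_lim -> //.
by apply: ereal_sup_ubound; exists M => //=; rewrite in_itv/= M0.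
Qed.

(** * Growth of the absorption term *)

(** As [1 / gspeed] decreases, its integral over [[s / 2, s]] is at least
    [s / (2 gspeed s)], and it is at most [Phi 1] because [s / 2 >= 1]. *)
Lemma gspeed_ge s : 2 <= s -> s <= 2 * Phi beta 1 * gspeed s.
Proof.
move=> s2; have s0 : 0 < s by lra.
have h0 : 0 < s / 2 by lra.
have [c /andP[sc cs] E] := @Phi_mvt (s / 2) s h0 ltac:(lra).
have P1 : Phi beta (s / 2) <= Phi beta 1 by apply: Phi_nincr; lra.
have gc : gspeed c <= gspeed s by apply: gspeed_homo; lra.
have gc0 : 0 < gspeed c by apply: gspeed_gt0; lra.
have : (s - s / 2) / gspeed c <= Phi beta 1.
  by rewrite -E; have := Phi_ge0 s; lra.
rewrite ler_pdivrMr// => le1.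
have : Phi beta 1 * gspeed c <= Phi beta 1 * gspeed s by rewrite ler_wpM2l// Phi_ge0.
lra.
Qed.

(** From [gspeed s ^+ 2 = 2 * G s <= 2 * s * beta s] and the linear lower bound
    [gspeed_ge] on [gspeed s]. *)
Lemma gspeed_le_beta s : 2 <= s -> gspeed s <= 4 * Phi beta 1 * beta s.
Proof.
move=> s2; have s0 : 0 < s by lra.
have g0 := gspeed_gt0 s0; have b0 := beta_gt0 s0.
rewrite -(ler_pM2r g0) -expr2 sqr_gspeed//.
have := gspeed_ge s2; have := G_le s0.
set P := Phi beta 1; move=> Gs gs.
have : beta s * s <= beta s * (2 * P * gspeed s) by rewrite ler_wpM2l// ltW.
lra.
Qed.

(** Combining [gspeed_ge] and [gspeed_le_beta], [beta] grows at least linearly. *)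
Lemma beta_unbounded y : exists2 M, 2 <= M & y <= beta M.
Proof.
have P0 := Phi_gt0 ltr01.
pose C := 8 * Phi beta 1 ^+ 2.
have C0 : 0 < C by rewrite mulr_gt0// exprn_gt0.
exists (Num.max 2 (C * y)); first by rewrite le_max lexx.
set M := Num.max _ _; have M2 : 2 <= M by rewrite le_max lexx.
rewrite -(ler_pM2l C0); apply: (@le_trans _ _ M); first by rewrite le_max lexx orbT.
apply: (le_trans (gspeed_ge M2)).
have : 2 * Phi beta 1 * gspeed M <= 2 * Phi beta 1 * (4 * Phi beta 1 * beta M).
  by rewrite ler_pM2l ?gspeed_le_beta// mulr_gt0.
by move=> /le_trans; apply; rewrite /C le_eqVlt; apply/orP; left; apply/eqP; ring.
Qed.

Lemma beta_invP y : 0 <= y -> 0 <= beta_inv beta y /\ beta (beta_inv beta y) = y.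
Proof.
move=> y0; have [S S2 yS] := beta_unbounded y; have S0 : 0 <= S by lra.
have [||s + sE] := @IVT R beta 0 S y S0.
- apply: continuous_subspaceW beta_continuous => x /=.
  by rewrite !in_itv/= => /andP[->].
- by rewrite beta0 ge_min y0 le_max yS orbT.
rewrite in_itv/= => /andP[s0 _].
have yim : y \in beta @` `[0, +oo[.
  by rewrite inE; exists s => //=; rewrite in_itv/= s0.
split; last exact: pinvK.
have sb : set_surj (`[0, +oo[ : set R) (beta @` `[0, +oo[) beta by [].
have : `[0, +oo[%classic (beta_inv beta y).
  by apply: (surjpinv_image_sub sb); exists y => //; exact: set_mem.
by rewrite /= in_itv/= andbT.
Qed.

(** * The one-dimensional profile *)

Section profile.
Variables (kappa c0 r M : R).
Hypotheses (kappa_gt0 : 0 < kappa) (M_gt0 : 0 < M).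
Hypothesis kappa_lt : kappa * r ^+ 2 < Phi beta M.

Definition profile_arg s := kappa * (r ^+ 2 - `|s - c0| ^+ 2).
Definition profile s := Phi_inv beta (profile_arg s).
(** [profile1] and [profile2] are the first two derivatives of [profile]. *)
Definition profile1 s := 2 * kappa * (s - c0) * gspeed (profile s).
Definition profile2 s := 2 * kappa * gspeed (profile s) +
  4 * kappa ^+ 2 * (s - c0) ^+ 2 * beta (profile s).

Lemma profile_arg_itv s : `|s - c0| < r -> 0 < profile_arg s < Phi beta M.
Proof.
move=> sr; have n0 := normr_ge0 (s - c0).
have lt2 : `|s - c0| ^+ 2 < r ^+ 2 by rewrite ltr_sqr ?nnegrE//; lra.
rewrite /profile_arg mulr_gt0 ?subr_gt0//=; apply: le_lt_trans kappa_lt.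
by rewrite ler_pM2l// lerBlDr lerDl exprn_ge0.
Qed.

Lemma profile_gt s : `|s - c0| < r -> M < profile s.
Proof. by move=> /profile_arg_itv/(Phi_inv_gt M_gt0). Qed.

Lemma is_derive_profile_arg s :
  is_derive s 1 profile_arg (- (2 * kappa * (s - c0))).
Proof.
have -> : profile_arg = kappa *: (cst (r ^+ 2) - (id - cst c0) ^+ 2).
  by apply/funext => t; rewrite /profile_arg real_normK ?num_real.
apply: is_derive_eq.
rewrite !fctE /GRing.scale /=; ring.
Qed.

Lemma is_derive_profile s : `|s - c0| < r -> is_derive s 1 profile (profile1 s).
Proof.
move=> /profile_arg_itv sM.
have := @is_derive1_comp R (Phi_inv beta) profile_arg s _ _
  (is_derive_Phi_inv M_gt0 sM) (is_derive_profile_arg s).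
by move=> /is_derive_eq; apply; rewrite /profile1 /profile; ring.
Qed.

Lemma is_derive_profile1 s : `|s - c0| < r -> is_derive s 1 profile1 (profile2 s).
Proof.
move=> /profile_arg_itv sM.
have dg := @is_derive1_comp R (fun z => - gspeed (Phi_inv beta z)) profile_arg s _ _
  (is_derive_gspeed_Phi_inv M_gt0 sM) (is_derive_profile_arg s).
have dl : is_derive s 1 (- (2 * kappa) *: (id - cst c0)) (- (2 * kappa)).
  by apply: is_derive_eq; rewrite subr0 [LHS]mulr1.
have := is_deriveM dl dg.
have -> : - (2 * kappa) *: (id - cst c0) *
    ((fun z => - gspeed (Phi_inv beta z)) \o profile_arg) = profile1.
  by apply/funext => t; rewrite /profile1 /profile !fctE /GRing.scale/=; ring.
move=> /is_derive_eq; apply.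
by rewrite /profile2 /profile !fctE /GRing.scale/=; ring.
Qed.

Lemma profile_continuous s : `|s - c0| < r -> {for s, continuous profile}.
Proof.
move=> sr; apply: differentiable_continuous; apply/derivable1_diffP.
by have [] := is_derive_profile sr.
Qed.

Lemma profile2_ge0 s : `|s - c0| < r -> 0 <= profile2 s.
Proof.
move=> sr; have h0 := lt_trans M_gt0 (profile_gt sr).
have k0 := ltW kappa_gt0; have b0 := ltW (beta_gt0 h0).
have e1 : 0 <= kappa * gspeed (profile s) by rewrite mulr_ge0 ?sqrtr_ge0.
have e2 := mulr_ge0 (mulr_ge0 (sqr_ge0 kappa) (sqr_ge0 (s - c0))) b0.
by rewrite /profile2; lra.
Qed.

Lemma profile2_le s : 2 <= M -> `|s - c0| < r ->
  profile2 s <=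
    (8 * kappa * Phi beta 1 + 4 * kappa ^+ 2 * r ^+ 2) * beta (profile s).
Proof.
move=> M2 sr; have hM := profile_gt sr; have h0 := lt_trans M_gt0 hM.
have b0 := beta_gt0 h0; have n0 := normr_ge0 (s - c0).
rewrite mulrDl lerD//.
  have -> : 8 * kappa * Phi beta 1 * beta (profile s) =
    2 * kappa * (4 * Phi beta 1 * beta (profile s)) by ring.
  by rewrite ler_wpM2l ?mulr_ge0 ?(ltW kappa_gt0)// gspeed_le_beta//; lra.
rewrite ler_wpM2r ?(ltW b0)// ler_wpM2l ?mulr_ge0 ?(ltW kappa_gt0)//.
by rewrite -(real_normK (num_real (s - c0))) ler_sqr ?nnegrE//; lra.
Qed.

End profile.

(** The distance [r - rho] to the ends at which the profile exceeds [U] does not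
    depend on the centre, so that all the coordinates of a cube share it. *)
Lemma profile_blowup (kappa r M U : R) : 0 < kappa -> kappa * r ^+ 2 < Phi beta M ->
  0 < r -> exists2 rho, 0 <= rho < r &
  forall c0 s, rho < `|s - c0| < r -> U < profile kappa c0 r s.
Proof.
move=> kappa_gt0 kappa_lt r0; pose M' := Num.max U 1.
have M'0 : 0 < M' by rewrite lt_max ltr01 orbT.
have P0 := Phi_gt0 M'0.
(* [r ^+ 2 - `|s - c0| ^+ 2 < eta] puts the argument of [Phi_inv] below
   [Phi M'], and [eta <= r ^+ 2] makes [rho] well defined *)
pose eta := Num.min (r ^+ 2) (Phi beta M' / kappa).
have eta0 : 0 < eta by rewrite lt_min exprn_gt0//= divr_gt0.
have eta_le : eta <= r ^+ 2 by rewrite ge_min lexx.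
exists (Num.sqrt (r ^+ 2 - eta)).
  rewrite sqrtr_ge0 -[X in _ < X]ger0_norm ?(ltW r0)// -sqrtr_sqr.
  rewrite ltr_sqrt ?exprn_gt0//.
  by rewrite ltrBlDr ltrDl.
move=> c0 s /andP[rs sr]; apply: (@le_lt_trans _ _ M'); first by rewrite le_max lexx.
apply: Phi_inv_gt => //; have /andP[-> _] := profile_arg_itv kappa_gt0 kappa_lt sr.
have : r ^+ 2 - eta < `|s - c0| ^+ 2.
  rewrite -[X in X < _]sqr_sqrtr ?subr_ge0// ltr_sqr ?nnegrE ?sqrtr_ge0//.
move=> lt1; apply: (@lt_le_trans _ _ (kappa * eta)).
  by rewrite /profile_arg ltr_pM2l//; lra.
have : eta <= Phi beta M' / kappa by rewrite ge_min lexx orbT.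
by rewrite ler_pdivlMr// mulrC.
Qed.

(** * The barrier and the comparison argument *)

Section comparison.
Variables (N : nat) (x0 : 'rV[R]_N) (kappa r M c : R).
Hypotheses (kappa_gt0 : 0 < kappa) (M_ge2 : 2 <= M).
Hypothesis kappa_lt : kappa * r ^+ 2 < Phi beta M.
Hypothesis c_ge0 : 0 <= c.

Let M_gt0 : 0 < M. Proof. by apply: lt_le_trans M_ge2. Qed.

Let prof i : R -> R := profile kappa (x0 0 i) r.
Let prof2 i : R -> R := profile2 kappa (x0 0 i) r.

Definition barrier (x : 'rV[R]_N) : R := \sum_i prof i (x 0 i) + c.

Definition barrier_hessian (z : 'rV[R]_N) : 'M[R]_N :=
  diag_mx (\row_i prof2 i (z 0 i)).

Lemma barrier_line2 (z xi : 'rV[R]_N) : cube x0 r z -> exists v1 : R -> R,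
  (\forall t \near (0 : R),
    is_derive (t : R) 1 (fun t => barrier (z + t *: xi)) (v1 t)) /\
  is_derive (0 : R) 1 v1 (bform (barrier_hessian z) xi xi).
Proof.
move=> cz.
pose l i (t : R) : R := (z + t *: xi) 0 i.
have dl i (t : R) : is_derive t 1 (l i) (xi 0 i).
  have -> : l i = cst (z 0 i) + xi 0 i *: id.
    by apply/funext => s; rewrite /l !mxE !fctE /GRing.scale/= mulrC.
  apply: is_derive_eq (is_deriveD (is_derive_cst (z 0 i) t 1)
    (is_deriveZ (xi 0 i) (is_derive_id t 1))) _.
  by rewrite add0r; exact: mulr1.
exists (\sum_i (xi 0 i *: (profile1 kappa (x0 0 i) r \o l i))); split.
  apply: filterS (cube_near_line xi cz) => t ct.
  have -> : (fun t => barrier (z + t *: xi)) = \sum_i (prof i \o l i) + cst c.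
    by apply/funext => s; rewrite /barrier !fctE fct_sumE.
  have dp i : is_derive t 1 (prof i \o l i)
      (profile1 kappa (x0 0 i) r (l i t) * xi 0 i).
    exact: (is_derive1_comp (is_derive_profile kappa_gt0 M_gt0 kappa_lt (ct i))).
  have := is_deriveD (is_derive_sum dp) (is_derive_cst c t 1).
  move=> /is_derive_eq; apply; rewrite addr0 fct_sumE.
  by apply: eq_bigr => i _; rewrite !fctE /GRing.scale/= mulrC.
have l0 i : l i 0 = z 0 i by rewrite /l scale0r addr0.
have dp i : is_derive (0 : R) 1 (xi 0 i *: (profile1 kappa (x0 0 i) r \o l i))
    (xi 0 i *: (prof2 i (z 0 i) * xi 0 i)).
  apply: is_deriveZ; apply: is_derive1_comp; rewrite l0.
  exact: (is_derive_profile1 kappa_gt0 M_gt0 kappa_lt (cz i)).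
apply: is_derive_eq (is_derive_sum dp) _.
rewrite /bform mul_mx_diag mxE; apply: eq_bigr => i _.
by rewrite !mxE /GRing.scale/= mulrA.
Qed.

Lemma barrier_continuous (x : 'rV[R]_N) : cube x0 r x -> {for x, continuous barrier}.
Proof.
move=> cx.
have cc : {for x, continuous (fun _ : 'rV[R]_N => c)} by exact: cst_continuous.
rewrite /barrier; apply: continuousD cc.
have -> : (fun y : 'rV[R]_N => \sum_i prof i (y 0 i)) =
    \sum_i (prof i \o (fun y : 'rV[R]_N => y 0 i)).
  by apply/funext => y; rewrite fct_sumE.
apply: (big_ind (fun g : 'rV[R]_N -> R => {for x, continuous g})).
- exact: cst_continuous.
- by move=> g1 g2; exact: continuousD.
- move=> i _; apply: continuous_comp; first exact: coord_continuous.
  exact: (profile_continuous kappa_gt0 M_gt0 kappa_lt (cx i)).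
Qed.

Lemma profile_le_barrier (x : 'rV[R]_N) i :
  cube x0 r x -> prof i (x 0 i) <= barrier x.
Proof.
move=> cx; rewrite /barrier (bigD1 i)//= -addrA lerDl addr_ge0// sumr_ge0// => j _.
by apply/ltW/(lt_trans M_gt0); exact: (profile_gt kappa_gt0 M_gt0 kappa_lt (cx j)).
Qed.

(** Every profile exceeds [M], where [beta] is at least twice [beta c]: half of
    [beta (barrier z)] absorbs [beta c], and the other half absorbs the second
    order terms.  The factor [Lambda + 1] accounts for [cA] and for [eps] times
    the laplacian. *)
Lemma barrier_supersolution Lambda z : (0 < N)%N -> 0 <= Lambda ->
  (Lambda + 1) * (8 * kappa * Phi beta 1 + 4 * kappa ^+ 2 * r ^+ 2) * N%:R
    <= 1 / 2 ->
  2 * beta c <= beta M -> cube x0 r z ->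
  (Lambda + 1) * (\sum_i prof2 i (z 0 i)) <= beta (barrier z) - beta c.
Proof.
move=> N0 L0 small cM cz; set b := beta (barrier z).
set q := 8 * _ * _ + _ in small.
have hM i := profile_gt kappa_gt0 M_gt0 kappa_lt (cz i).
have q0 : 0 <= q.
  have e1 : 0 <= kappa * Phi beta 1 by rewrite mulr_ge0 ?Phi_ge0// ltW.
  have e2 := mulr_ge0 (sqr_ge0 kappa) (sqr_ge0 r).
  by rewrite /q; lra.
have bi i : beta (prof i (z 0 i)) <= b.
  apply: beta_le; last exact: (profile_le_barrier i cz).
  exact/ltW/(lt_trans M_gt0)/hM.
have Mb : beta M <= b.
  apply: le_trans (bi (Ordinal N0)).
  by apply: beta_le; apply: ltW; [exact: M_gt0|exact: hM].
have sq : \sum_i prof2 i (z 0 i) <= \sum_(i < N) q * b.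
  apply: ler_sum => i _.
  apply: (le_trans (profile2_le kappa_gt0 M_gt0 kappa_lt M_ge2 (cz i))).
  exact: (ler_wpM2l q0 (bi i)).
move: sq; rewrite sumr_const card_ord -[_ *+ N]mulr_natr => sq.
have L10 : 0 <= Lambda + 1 by lra.
have := ler_wpM2l L10 sq.
have b0 : 0 <= b by apply: le_trans Mb; apply: beta_ge0; exact: ltW M_gt0.
have := ler_wpM2r b0 small.
move=> h1 h2; apply: (le_trans h2).
have -> : (Lambda + 1) * (q * b * N%:R) = (Lambda + 1) * q * N%:R * b by ring.
lra.
Qed.

(** At an interior maximum [z] of [u - barrier] with positive value, the ordering
    of the hessians and [barrier_supersolution] give
    [beta (u z) <= beta (barrier z)], which forces [u z <= barrier z]. *)
Lemma solution_le_barrier (Omega : set 'rV[R]_N) (cA : 'rV[R]_N -> 'M[R]_N)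
    (f : 'rV[R]_N -> R) (Lambda eps : R) (n : nat) (u : 'rV[R]_N -> R) :
  (0 < N)%N -> 0 < r -> open Omega -> closure (cube x0 r) `<=` Omega ->
  (forall z, Omega z -> symmetric_mx (cA z)) ->
  (forall z xi, Omega z -> 0 <= bform (cA z) xi xi) ->
  (forall z i, Omega z -> cA z i i <= Lambda) -> 0 <= Lambda ->
  (Lambda + 1) * (8 * kappa * Phi beta 1 + 4 * kappa ^+ 2 * r ^+ 2) * N%:R
    <= 1 / 2 ->
  2 * beta c <= beta M ->
  (forall z, cube x0 r z -> f z <= beta c) ->
  0 < eps < 1 -> classical_solution Omega cA beta f eps n u ->
  forall z, cube x0 r z -> u z <= barrier z.
Proof.
move=> N0 r0 Omega_open cO sA pA dA L0 small cM fc /andP[eps0 eps1].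
move=> [C2u _ _ pde _] x cx.
have subO (y : 'rV[R]_N) : cube x0 r y -> Omega y.
  by move=> cy; apply/cO/subset_closure.
rewrite leNgt; apply/negP => ux.
have cu (y : 'rV[R]_N) : Omega y -> {for y, continuous u} by move=> /C2u[].
have [U UP] : exists U, forall y : 'rV[R]_N, cube x0 r y -> u y <= U.
  have [||p _ pmax] := @compact_EVT_max _ R u (closure (cube x0 r)) _
    (closure_cube_compact (x0 := x0) (r := r)).
  - by exists x; exact: subset_closure.
  - by apply: continuous_in_subspaceT => y; rewrite inE => /cO; exact: cu.
  by exists (u p) => y cy; apply: pmax; rewrite inE; exact: subset_closure.
have [rho rho_itv blow] : exists2 rho, 0 <= rho < r &
    forall c0 s, rho < `|s - c0| < r -> U < profile kappa c0 r s.
  exact: profile_blowup kappa_gt0 kappa_lt r0.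
have out (y : 'rV[R]_N) : cube x0 r y -> ~ box x0 rho y -> u y < barrier y.
  move=> cy /existsNP[i /negP]; rewrite -ltNge => yi.
  apply: le_lt_trans (UP y cy) _; apply: lt_le_trans (profile_le_barrier i cy).
  by apply: blow; rewrite yi cy.
have box_cube (y : 'rV[R]_N) : box x0 rho y -> cube x0 r y.
  by move=> by_ i; apply: le_lt_trans (by_ i) _; case/andP: rho_itv.
have bx : box x0 rho x.
  by apply: contrapT => /(out _ cx) /(lt_trans ux); rewrite ltxx.
have [||z zbox zmax] := @compact_EVT_max _ R
  (fun y : 'rV[R]_N => u y - barrier y) (box x0 rho) _
  (box_compact (x0 := x0) (r := rho)).
- by exists x.
- apply: continuous_in_subspaceT => y; rewrite inE => /box_cube cy.
  exact: (continuousB (cu y (subO y cy)) (barrier_continuous cy)).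
rewrite inE in zbox; have cz := box_cube _ zbox; have Oz := subO _ cz.
have zpos : 0 < u z - barrier z.
  by apply: lt_le_trans (zmax x _); rewrite ?subr_gt0// inE.
have glob (y : 'rV[R]_N) : cube x0 r y -> u y - barrier y <= u z - barrier z.
  move=> cy; have [by_|/(out _ cy)] := pselect (box x0 rho y).
    by apply: zmax; rewrite inE.
  by rewrite -subr_lt0 => /ltW/le_trans; apply; exact: ltW.
have Hle : forall xi, bform (hessian u z - barrier_hessian z) xi xi <= 0.
  apply: (hessian_le_at_max Omega_open C2u Oz) => xi; first exact: barrier_line2.
  by apply: filterS (cube_near_line xi cz) => t; exact: glob.
have trA := psd_nsd_trace (sA _ Oz) (fun xi => pA z xi Oz) Hle.
pose S := \sum_i prof2 i (z 0 i).
have S0 i : 0 <= prof2 i (z 0 i).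
  exact: (profile2_ge0 kappa_gt0 M_gt0 kappa_lt (cz i)).
have lap : laplacian u z <= S.
  apply: ler_sum => i _; have := Hle (delta_mx 0 i).
  by rewrite bform_delta !mxE eqxx mulr1n subr_le0.
have trS : \tr (cA z *m barrier_hessian z) <= Lambda * S.
  rewrite mul_mx_diag /mxtrace mulr_sumr; apply: ler_sum => i _; rewrite !mxE.
  by rewrite ler_wpM2r//; exact: dA.
move: trA; rewrite mulmxBr linearB/= => trA.
have super := barrier_supersolution N0 L0 small cM cz.
have epsS : eps * laplacian u z <= S.
  apply: le_trans (_ : eps * S <= _); first by rewrite ler_pM2l.
  by rewrite -[leRHS]mul1r ler_wpM2r ?sumr_ge0 ?(ltW eps1)// => i _.
have := pde _ Oz; have fz := fc _ cz.
have : Num.min (f z) n%:R <= f z by rewrite ge_min lexx.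
have bzu : beta (barrier z) < beta (u z).
  apply: beta_increasing; last by rewrite -subr_gt0.
  apply: le_trans (profile_le_barrier (Ordinal N0) cz).
  by apply/ltW/(lt_trans M_gt0); exact: (profile_gt kappa_gt0 M_gt0 kappa_lt (cz _)).
rewrite mulrDl mul1r -/S in super.
set mf := Num.min _ _; set TA := \tr (cA z *m hessian u z) in trA *.
lra.
Qed.

End comparison.

End absorption.

(** * Choice of the constants *)

Lemma exists_small (R : realType) (a b c : R) : 0 <= a -> 0 <= b -> 0 < c ->
  exists k : R, [/\ 0 < k, k * a < c & k * b <= c].
Proof.
move=> a0 b0 c0; exists (c / (a + b + 1)).
have d0 : 0 < a + b + 1 by lra.
split; first by rewrite divr_gt0.
- by rewrite mulrAC ltr_pdivrMr// ltr_pM2l//; lra.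
- by rewrite mulrAC ler_pdivrMr// ler_pM2l//; lra.
Qed.

Lemma enorm_delta (R : realType) (N : nat) (i : 'I_N) :
  enorm (delta_mx 0 i : 'rV[R]_N) = 1.
Proof.
rewrite /enorm (bigD1 i)//= big1 ?addr0 => [|j ji].
  by rewrite mxE !eqxx expr1n sqrtr1.
by rewrite mxE eqxx/= (negbTE ji) expr0n.
Qed.

(** Nonnegativity on the unit sphere extends by homogeneity. *)
Lemma bform_ge0_sphere (R : realType) (N : nat) (A : 'M[R]_N) :
  (forall xi, enorm xi = 1 -> 0 <= bform A xi xi) ->
  forall xi, 0 <= bform A xi xi.
Proof.
move=> A1 xi; pose s := \sum_(i < N) xi 0 i ^+ 2.
have s0 : 0 <= s by apply: sumr_ge0 => i _; exact: sqr_ge0.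
have [sE|sN0] := eqVneq s 0.
  have -> : xi = 0.
    apply/rowP => i; rewrite mxE; apply/eqP; rewrite -sqrf_eq0.
    move/eqP : sE; rewrite psumr_eq0 => [/allP/(_ i)|j _]; last exact: sqr_ge0.
    by rewrite mem_index_enum => /(_ isT).
  by rewrite /bform !mul0mx mxE.
have e0 : 0 < enorm xi by rewrite sqrtr_gt0 lt_def sN0.
have := A1 ((enorm xi)^-1 *: xi).
rewrite bformZl bformZr !pmulr_rge0 ?invr_gt0//; apply.
rewrite /enorm; under eq_bigr do rewrite mxE exprMn.
rewrite -mulr_sumr sqrtrM ?sqr_ge0// sqrtr_sqr ger0_norm ?invr_ge0 ?sqrtr_ge0//.
by rewrite mulVf// gt_eqF.
Qed.

Lemma cube_radius_le (R : realType) (N : nat) (x0 : 'rV[R]_N) (r Q : R) :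
  (0 < N)%N -> 0 < r -> cube x0 r `<=` box 0 Q -> r <= 4 * Q.
Proof.
move=> N0 r0 cQ; pose i := Ordinal N0.
have c1 : cube x0 r x0 by move=> j; rewrite subrr normr0.
have c2 : cube x0 r (x0 + (r / 2) *: delta_mx 0 i).
  move=> j; rewrite !mxE addrAC subrr add0r eqxx/=; case: (j == i) => /=.
    by rewrite mulr1 gtr0_norm; lra.
  by rewrite mulr0 normr0.
have := cQ _ c1 i; have := cQ _ c2 i.
by rewrite !mxE !eqxx/= !subr0 mulr1 !ler_norml; lra.
Qed.

Theorem theorem4p3 (R : realType) (N : nat) (Omega : set 'rV[R]_N)
    (cA : 'rV[R]_N -> 'M[R]_N) (beta : R -> R) (f : 'rV[R]_N -> R)
    (Lambda : R) (omega : R -> R)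
    (N_gt1 : (1 < N)%N)
    (Omega_bounded : bounded_set Omega)
    (Omega_open : open Omega)
    (cA_psd : forall x, Omega x -> psd_mx (cA x) /\ cA x <> 0)
    (cA_lipschitz : [lipschitz cA x | x in Omega])
    (beta_ge0 : forall s, 0 <= s -> 0 <= beta s)
    (beta_continuous : {within `[0, +oo[, continuous beta})
    (beta_increasing : forall s t, 0 <= s -> s < t -> beta s < beta t)
    (beta0 : beta 0 = 0)
    (f_ge0 : forall x, Omega x -> 0 <= f x)
    (f_unif_continuous : unif_continuous_on Omega f)
    (Lambda_gt0 : 0 < Lambda)
    (cA_bound : forall x xi, Omega x -> enorm xi = 1 ->
       0 <= \tr (cA x *m tens xi) <= Lambda)
    (beta_KO : keller_osserman beta)
    (omega_ge0 : forall s, 0 <= s -> 0 <= omega s)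
    (omega0 : omega s @[s --> 0^'+] --> 0)
    (cA_structure : structure_condition Omega cA omega) :
  exists A B : R, [/\ 0 < A, 0 < B &
    forall (x0 : 'rV[R]_N) (r : R),
      0 < r -> closure (cube x0 r) `<=` Omega ->
      ((B * r ^+ 2 / Num.sqrt (Lambda + 1))%:E < Phi0 beta)%E /\
      forall (eps : R) (un : nat -> 'rV[R]_N -> R),
        0 < eps < 1 ->
        (forall n, classical_solution Omega cA beta f eps n (un n)) ->
        forall x, cube x0 r x ->
          (sup_seq un x <=
           (\sum_(i < N)
              Psi1 beta Lambda A B (r ^+ 2 - `|x 0 i - x0 0 i| ^+ 2)
            + beta_inv beta (sup_norm (cube x0 r) f))%:E)%E].
Proof.
have N_gt0 : (0 < N)%N by exact: ltnW.
have [F F0 fF] := unif_continuous_bounded Omega_bounded f_unif_continuous.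
have [Q Q0 OQ] := bounded_in_box Omega_bounded.
have [M M2 FM] : exists2 M, 2 <= M & 2 * F <= beta M by exact: beta_unbounded.
have M0 : 0 < M by lra.
have PM : 0 < Phi beta M by exact: Phi_gt0.
have P1 := Phi_ge0 beta 1.
set P := Phi beta 1 in P1.
(* [D] bounds the squared radius of any cube inside [Omega]; [C] bounds the
   coefficient in [barrier_supersolution] divided by [kappa], when [kappa <= 1]. *)
pose D := (4 * Q) ^+ 2.
have D0 : 0 <= D by exact: sqr_ge0.
pose C := (Lambda + 1) * (8 * P + 4 * D) * N%:R.
have C0 : 0 <= C by rewrite /C !mulr_ge0//; lra.
have c0 : 0 < Num.min (Phi beta M) (1 / 2) by rewrite lt_min PM/=; lra.
have [kappa [k0 k1 kD kC]] : exists k : R,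
    [/\ 0 < k, k <= 1, k * D < Phi beta M & k * C <= 1 / 2].
  have [|k [k0]] := exists_small D0 _ c0 (b := C + 1); first lra.
  rewrite lt_min le_min => /andP[kD _] /andP[_ kC]; exists k.
  have : 0 <= k * C by rewrite mulr_ge0// ltW.
  by split=> //; lra.
have sL : 0 < Num.sqrt (Lambda + 1) by rewrite sqrtr_gt0; lra.
exists 1, (kappa * Num.sqrt (Lambda + 1)); split => //; first by rewrite mulr_gt0.
move=> x0 r r0 cO.
have rQ : r <= 4 * Q.
  by apply: (cube_radius_le N_gt0 r0 (x0 := x0)) => y cy; apply/OQ/cO/subset_closure.
have r2D : r ^+ 2 <= D by rewrite ler_sqr ?nnegrE//; lra.
have kM : kappa * r ^+ 2 < Phi beta M.
  by apply: le_lt_trans kD; rewrite ler_pM2l.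
split.
  rewrite mulrAC mulfK ?gt_eqF//.
  apply: lt_le_trans (_ : (Phi beta M)%:E <= _)%E; last exact: Phi_le_Phi0.
  by rewrite lte_fin.
move=> eps un eps01 sol x cx.
have subO y : cube x0 r y -> Omega y by move=> cy; apply/cO/subset_closure.
set S := sup_norm _ _.
have SF : S <= F.
  by apply: sup_le_ub => [|_ [y cy <-]]; [exists `|f x|, x|exact/fF/subO].
have fS y : cube x0 r y -> f y <= S.
  move=> cy; apply: le_trans (ler_norm _) _; apply: ub_le_sup; last by exists y.
  by exists F => _ [w cw <-]; exact/fF/subO.
have S0 : 0 <= S by apply: le_trans (f_ge0 _ (subO _ cx)) (fS _ cx).
have [cge bc] : 0 <= beta_inv beta S /\ beta (beta_inv beta S) = S.
  exact: beta_invP.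
set c := beta_inv beta S in cge bc *.
apply: ub_ereal_sup => _ [n _ <-]; rewrite lee_fin.
have -> : \sum_i Psi1 beta Lambda 1 (kappa * Num.sqrt (Lambda + 1))
    (r ^+ 2 - `|x 0 i - x0 0 i| ^+ 2) + c = barrier beta x0 kappa r c x.
  rewrite /barrier; congr (_ + _); apply: eq_bigr => i _.
  by rewrite /Psi1 invr1 mul1r mulfK ?gt_eqF.
have bform_ge0 z xi : Omega z -> 0 <= bform (cA z) xi xi.
  move=> Oz; apply: bform_ge0_sphere => eta eta1.
  by rewrite -mxtrace_tens; have /andP[] := cA_bound _ _ Oz eta1.
apply: (solution_le_barrier beta_ge0 beta_continuous beta_increasing beta0 beta_KO
  k0 M2 kM cge N_gt0 r0 Omega_open cO _ bform_ge0 _ (ltW Lambda_gt0) _ _ _ eps01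
  (sol n) cx).
- by move=> z /cA_psd[[]].
- move=> z i Oz; rewrite -bform_delta -mxtrace_tens.
  by have /andP[] := cA_bound _ _ Oz (enorm_delta R i).
- apply: le_trans kC.
  have -> : kappa * C = (Lambda + 1) * (kappa * (8 * P + 4 * D)) * N%:R.
    by rewrite /C; ring.
  apply: ler_wpM2r => //; apply: ler_wpM2l; first lra.
  have : kappa ^+ 2 * r ^+ 2 <= kappa * D.
    by apply: ler_pM; rewrite ?sqr_ge0// expr2 ler_piMl// ltW.
  by rewrite -/P; lra.
- by rewrite bc; lra.
- by move=> z cz; rewrite bc; exact: fS.
Qed.
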